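(* Let $k\ge 2$. The edge polytope $\mathcal{P}(G)$ of a graph $G$ with at least $k$ edges is $k$-neighborly if and only if $G$ is $\mathcal{F}_k$-free.
   Context: All graphs are finite, undirected, without loops, multiple edges or isolated vertices. For a graph $G$ on vertex set $[n]$, the edge polytope is $\mathcal{P}(G)=\mathrm{conv}\{e_i+e_j : \{i,j\}\in E(G)\}\subseteq\mathbb{R}^n$. A polytope $P$ is $k$-neighborly if every subset of at most $k$ of its vertices is the vertex set of a face of $P$. For $k\ge 2$, $\mathcal{F}_k$ is the family of graphs on at most $2k$ vertices consisting of (a) even cycles, and (b) graphs obtained by joining two odd cycles by a path (the path may have length $0$, i.e. the two odd cycles share exactly one vertex; e.g. $\mathcal{F}_3$ consists of $C_4$, two triangles sharing one vertex, two disjoint triangles joined by an edge, and $C_6$). A graph is $\mathcal{F}$-free if it contains no subgraph isomorphic to a member of $\mathcal{F}$. *)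

(* Defs.v *)
From mathcomp Require Import all_boot all_order all_algebra.
From mathcomp Require Import classical_sets functions cardinality reals.

Set Implicit Arguments.
Unset Strict Implicit.
Unset Printing Implicit Defensive.

Import Order.TTheory GRing.Theory Num.Theory.

(* Finite simple graphs on the vertex set 'I_n, without isolated vertices. *)
Record graph (n : nat) := Graph {
  adj : rel 'I_n;
  adj_sym : symmetric adj;
  adj_irrefl : irreflexive adj;
  adj_no_isolated : forall i, exists j, adj i j
}.

Definition edges n (G : graph n) : {set {set 'I_n}} :=
  [set e | [exists i, exists j, adj G i j && (e == [set i; j])]].

(* An injective edge-preserving map H -> G is an isomorphism of H onto a
   subgraph of G, which need not be induced. *)
Definition contains n m (G : graph n) (H : graph m) : Prop :=
  exists2 f : 'I_m -> 'I_n, injective f &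
    forall i j, adj H i j -> adj G (f i) (f j).

Definition cycle_seq (T : eqType) (c : seq T) : bool := uniq c && (2 < size c).

Definition cycle_edge (T : eqType) (c : seq T) : rel T :=
  fun i j => [&& i \in c, j \in c & (j == next c i) || (i == next c j)].

Definition path_edge (T : eqType) (w : seq T) : rel T :=
  fun i j => infix [:: i; j] w || infix [:: j; i] w.

Definition even_cycle m (H : graph m) : Prop :=
  exists c : seq 'I_m,
    [/\ cycle_seq c, ~~ odd (size c), forall i, i \in c
      & adj H =2 cycle_edge c].

(* The path x :: p has length size p; it meets c1 only in its first vertex
   and c2 only in its last one. *)
Definition joined_odd_cycles m (H : graph m) : Prop :=
  exists (c1 c2 : seq 'I_m) (x : 'I_m) (p : seq 'I_m),
    [/\ cycle_seq c1 && odd (size c1),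
        cycle_seq c2 && odd (size c2),
        uniq (x :: p),
        [/\ forall i, (i \in c1) && (i \in x :: p) = (i == x),
            forall i, (i \in c2) && (i \in x :: p) = (i == last x p)
          & forall i, (i \in c1) && (i \in c2) = (size p == 0) && (i == x)]
      & (forall i, [|| i \in c1, i \in c2 | i \in x :: p]) /\
        (forall i j, adj H i j =
           [|| cycle_edge c1 i j, cycle_edge c2 i j | path_edge (x :: p) i j])].

Definition family_F (k m : nat) (H : graph m) : Prop :=
  m <= 2 * k /\ (even_cycle H \/ joined_odd_cycles H).

Definition F_free (k n : nat) (G : graph n) : Prop :=
  forall (m : nat) (H : graph m), family_F k H -> ~ contains G H.

Local Open Scope ring_scope.
Local Open Scope classical_set_scope.
Local Open Scope card_scope.

Definition conv (R : realType) n (A : set 'rV[R]_n) : set 'rV[R]_n :=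
  [set x : 'rV[R]_n | exists (m : nat) (a : 'I_m -> 'rV[R]_n) (l : 'I_m -> R),
    [/\ forall i, A (a i), forall i, 0 <= l i, \sum_(i < m) l i = 1
      & x = \sum_(i < m) l i *: a i]].

(* The empty set (c = 0, b = 1) and P itself (c = 0, b = 0) are faces of P. *)
Definition face (R : realType) n (P F : set 'rV[R]_n) : Prop :=
  exists (c : 'rV[R]_n) (b : R),
    (forall x, P x -> \sum_(i < n) c 0 i * x 0 i <= b) /\
    F = P `&` [set x : 'rV[R]_n | \sum_(i < n) c 0 i * x 0 i = b].

Definition vertices (R : realType) n (P : set 'rV[R]_n) : set 'rV[R]_n :=
  [set v | face P [set v]].

Definition neighborly (R : realType) n (k : nat) (P : set 'rV[R]_n) : Prop :=
  forall A : set 'rV[R]_n, A `<=` vertices P -> A #<= `I_k ->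
    exists2 F, face P F & vertices F = A.

Definition edge_polytope (R : realType) n (G : graph n) : set 'rV[R]_n :=
  conv [set x : 'rV[R]_n | exists i j, adj G i j /\ x = delta_mx 0 i + delta_mx 0 j].

Arguments edge_polytope R {n} G.

(* Main.v *)
Require Import Defs.
From mathcomp Require Import all_boot all_order all_algebra.
From mathcomp Require Import boolp classical_sets cardinality reals zify.

(* A set A of edges is the vertex set of a face iff some weights c satisfy
   c_i + c_j <= 0 on all edges ij, with equality exactly on A.  This is a system
   of difference constraints on the signed copies (i, +), (i, -) of the vertices,
   so it is solvable iff no closed walk that takes every second step in A
   contains, at one of its other steps, an edge outside A.  An even cycle, or
   two joined odd cycles traversed with the path in both directions, is such a
   closed walk, for a suitable A with at most half as many edges as it has
   vertices (rounded down).  Conversely, in a shortest such walk each vertex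
   occurs at most once with each sign, and the loops between the two occurrences
   of a vertex do not cross; so either it is an even cycle or two consecutive
   innermost loops and the segment between them form two joined odd cycles.
   Each of its vertices is covered by A, so there are at most 2|A| of them. *)

Set Implicit Arguments.
Unset Strict Implicit.
Unset Printing Implicit Defensive.

Import Order.TTheory GRing.Theory Num.Theory.

(** * Alternating walks *)

(** Taking the earliest element whose value occurred before keeps the part preceding it free of
    repetitions, so the loop from [u] to [v] is innermost. *)
Lemma first_repetition (T : Type) (T' : eqType) (f : T -> T') (s : seq T) :
  ~~ uniq (map f s) ->
  exists q u r v t, [/\ s = q ++ u :: r ++ v :: t, f u = f v
    & uniq (map f (q ++ u :: r))].
Proof.
elim/last_ind: s => [//|s z IHs].
rewrite map_rcons rcons_uniq negb_and negbK.
case: (boolP (uniq (map f s))) => [us | /IHs [q [u [r [v [t [-> fuv uqr]]]]]] _].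
  rewrite orbF => fz_s.
  have [q [u [r [def_s fu]]]] : exists q u r, s = q ++ u :: r /\ f u = f z.
    elim: (s) fz_s => [//|y s' IH]; rewrite inE => /orP[/eqP-> | /IH].
      by exists [::], y, s'.
    by move=> [q [u [r [-> fu]]]]; exists (y :: q), u, r.
  exists q, u, r, z, [::]; split=> //; last by rewrite -def_s.
  by rewrite def_s -cats1 -!catA.
exists q, u, r, v, (rcons t z); split=> //.
by rewrite -!cats1 -!catA /= -!catA.
Qed.

Section AlternatingWalks.

Variables (T : eqType) (e a : rel T).

Definition flip (u : T * bool) : T * bool := (u.1, ~~ u.2).

(* The boolean of a node [(x, b)] tells which relation the next step out of [x]
   must use: [a] if it is [true], [e] if it is [false]. *)
Definition alt_step : rel (T * bool) := fun u v =>
  (v.2 == ~~ u.2) && (if u.2 then a u.1 v.1 else e u.1 v.1).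

Lemma flipK : involutive flip.
Proof. by case=> x b; rewrite /flip /= negbK. Qed.

Lemma alt_path_colour u p :
  path alt_step u p -> (last u p).2 = u.2 (+) odd (size p).
Proof.
elim: p u => [|v p IHp] u /=; first by rewrite addbF.
by case/andP=> /andP[/eqP v2 _] /IHp ->; rewrite v2 addNb addbN.
Qed.

Hypothesis e_sym : symmetric e.
Hypothesis a_sym : symmetric a.

(** The reversed step must use the same relation, the one announced by [u.2]; as [v.2] is its
    negation, [flip v] announces it. *)
Lemma alt_step_flip u v : alt_step (flip v) (flip u) = alt_step u v.
Proof.
case: u v => [x b] [y c]; rewrite /alt_step /flip /= negbK.
by case: b c => [] [] //=; rewrite 1?e_sym 1?a_sym.
Qed.

Lemma alt_path_flip u p v :
  path alt_step (flip v) (rcons (rev (map flip p)) (flip u)) =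
  path alt_step u (rcons p v).
Proof.
rewrite -[RHS]rev_path last_rcons belast_rcons rev_cons -map_rev -map_rcons.
by rewrite path_map; apply: eq_path => x y /=; rewrite alt_step_flip.
Qed.

(* A loop at [x] between the two nodes above [x] can be traversed backwards. *)
Lemma alt_cycle_flip_loop x b c1 c2 :
  cycle alt_step ((x, b) :: rev (map flip c1) ++ (x, ~~ b) :: c2) =
  cycle alt_step ((x, b) :: c1 ++ (x, ~~ b) :: c2).
Proof.
rewrite /= !rcons_cat /= -!cat_rcons !cat_path !last_rcons; congr (_ && _).
have -> : (x, ~~ b) = flip (x, b) by [].
by rewrite -[RHS]alt_path_flip flipK.
Qed.

End AlternatingWalks.

Lemma cycle_cat_loop (T : eqType) (r : rel T) u c1 c2 :
  cycle r (u :: c1 ++ u :: c2) = cycle r (u :: c1) && cycle r (u :: c2).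
Proof. by rewrite /= rcons_cat /= -cat_rcons cat_path last_rcons. Qed.

(** * Shortest alternating cycles *)

Section AlternatingCycles.

Variables (T : finType) (e a : rel T).
Hypothesis e_sym : symmetric e.
Hypothesis a_sym : symmetric a.
Hypothesis e_irr : irreflexive e.
Hypothesis sub_ae : subrel a e.

(** The steps governed by [a] lie in [a] anyway, so failing to be a cycle for [alt_step a a] means
    that some [e] step lies outside [a]. *)
Definition bad_cycle (c : seq (T * bool)) :=
  cycle (alt_step e a) c && ~~ cycle (alt_step a a) c.

Lemma bad_cycle_rot i c : bad_cycle (rot i c) = bad_cycle c.
Proof. by rewrite /bad_cycle !rot_cycle. Qed.

(** A repeated node cuts the cycle into two shorter alternating cycles, and a step outside [a]
    belongs to one of them. *)
Lemma bad_cycle_split c : bad_cycle c -> ~~ uniq c ->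
  exists2 c', bad_cycle c' & size c' < size c.
Proof.
move=> bad_c; rewrite -[c in uniq c]map_id.
case/first_repetition=> q [u [r [v [t [def_c uv _]]]]]; subst v.
have: bad_cycle (u :: r ++ u :: t ++ q).
  by rewrite -(bad_cycle_rot (size q)) def_c rot_size_cat /= -catA in bad_c.
rewrite {bad_c} /bad_cycle !cycle_cat_loop => /andP[/andP[ec1 ec2]].
rewrite def_c !size_cat /= size_cat negb_and => /orP[nac | nac].
  by exists (u :: r); rewrite ?ec1 //=; lia.
by exists (u :: t ++ q); rewrite ?ec2 //= size_cat; lia.
Qed.

(** The conclusion covers every bad cycle no longer than [c'], because it will be applied to cycles
    obtained by rotation and by reversing a loop. *)
Lemma bad_cycle_min c : bad_cycle c ->
  exists2 c', bad_cycle c' &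
    forall d, size d <= size c' -> bad_cycle d -> uniq d.
Proof.
move=> bad_c; pose P m := [exists t : m.-tuple (T * bool), bad_cycle t].
have exP : exists m, P m by exists (size c); apply/existsP; exists (in_tuple c).
case: (ex_minnP exP) => m /existsP[t bad_t] min_m; exists t => // d.
rewrite size_tuple => szd bad_d; apply: contraT => /(bad_cycle_split bad_d).
case=> d' bad_d' ltd; have := min_m (size d').
rewrite leqNgt (leq_trans ltd szd); apply.
by apply/existsP; exists (in_tuple d').
Qed.

Lemma alt_step_edge u v : alt_step e a u v -> e u.1 v.1.
Proof. by case/andP=> _; case: ifP => // _ /sub_ae. Qed.

Lemma alt_path_edge u p : path (alt_step e a) u p -> path e u.1 (unzip1 p).
Proof. by apply: homo_path => ? ?; apply: alt_step_edge. Qed.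

(** One of the two steps at a node is an [a] step: the outgoing one if its boolean is [true], the
    incoming one otherwise. *)
Lemma alt_cycle_cover c u : cycle (alt_step e a) c -> u \in c ->
  exists v, a u.1 v.
Proof.
move=> cyc uc; case u2: u.2.
  have /andP[_] := next_cycle cyc uc; rewrite u2 => a_un.
  by exists (next c u).1.
have /andP[/eqP] := prev_cycle cyc uc; rewrite u2.
by case: (prev c u).2 => // _; rewrite a_sym => ?; exists (prev c u).1.
Qed.

(** Distinct nodes above [x] have opposite booleans, so the number [(size c).+1] of steps is odd; it
    is not one because [e] is irreflexive. *)
Lemma alt_loop_odd x b b' c :
  path (alt_step e a) (x, b) (rcons c (x, b')) -> (x, b) != (x, b') ->
  odd (size c).+1 && (2 < (size c).+1).
Proof.
move=> pth; rewrite xpair_eqE eqxx => /= nbb'.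
have := alt_path_colour pth; rewrite last_rcons size_rcons /= => b'E.
have odd_c : ~~ odd (size c) by move: nbb'; rewrite b'E /=; case: (b); case: odd.
rewrite odd_c; case: c pth odd_c {b'E} => [|u [|v c]] //=.
by case/andP=> /alt_step_edge /=; rewrite e_irr.
Qed.

Lemma bad_cycle_extract c : bad_cycle c ->
  (exists C, [/\ cycle_seq C && ~~ odd (size C), cycle e C
     & forall v, v \in C -> exists w, a v w]) \/
  (exists C1 C2 x p,
    [/\ [/\ cycle_seq C1, odd (size C1), cycle_seq C2 & odd (size C2)],
        uniq (x :: p),
        [/\ forall i, (i \in C1) && (i \in x :: p) = (i == x),
            forall i, (i \in C2) && (i \in x :: p) = (i == last x p)
          & forall i, (i \in C1) && (i \in C2) = (size p == 0) && (i == x)],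
        [/\ cycle e C1, cycle e C2 & path e x p]
      & forall v, [|| v \in C1, v \in C2 | v \in x :: p] ->
          exists w, a v w]).
Proof.
case/bad_cycle_min=> {}c bad_c min_c.
have uc := min_c c (leqnn _) bad_c.
case: (boolP (uniq (unzip1 c))) => [uC | nuC].
  left; exists (unzip1 c); case/andP: bad_c => cyc nac.
  have even_c : ~~ odd (size c).
    case: (c) cyc => // u p /alt_path_colour.
    by rewrite last_rcons size_rcons /=; case: u.2; case: (odd _).
  split.
  - rewrite /cycle_seq uC size_map even_c !andbT.
    (* A cycle of length two runs along one edge in both directions; one step is in [a], hence by
       symmetry both are, and the cycle is not bad. *)
    case: c even_c cyc nac {min_c uc uC} => [|u [|v [|w c]]] //= _.
    rewrite !andbT => /andP[/andP[/eqP v2 auv] /andP[/eqP u2 avu]].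
    case/negP; rewrite /alt_step v2 eqxx negbK eqxx /=.
    by move: auv avu; rewrite v2; case: u.2 => /= ? ?; rewrite a_sym andbb // a_sym.
  - by case: (c) cyc => //= u p /alt_path_edge; rewrite /unzip1 map_rcons.
  - by move=> v /mapP[u u_c ->]; apply: alt_cycle_cover u_c.
right; have [q [[x b] [r [[x' b'] [t [def_c /= xx' uqr]]]]]] := first_repetition nuC.
(* Rotated to start at [(x, b)], the cycle consists of the loop [r] at [x] and the complementary
   loop [d]. *)
subst x'; pose d := t ++ q.
have [bad_d sz_d]: bad_cycle ((x, b) :: r ++ (x, b') :: d) /\
    size ((x, b) :: r ++ (x, b') :: d) = size c.
  rewrite -(bad_cycle_rot (size q)) def_c rot_size_cat /= -catA in bad_c.
  by split=> //; rewrite def_c /= !size_cat /= !size_cat /= ?size_cat; lia.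
have ud := min_c _ (eq_leq sz_d) bad_d.
have b'E : b' = ~~ b.
  move: ud; rewrite /= mem_cat inE xpair_eqE eqxx /=.
  by case: b {bad_d sz_d uqr def_c}; case: b' => //=; rewrite orbT.
subst b'.
(* If a loop at [x] and its complement share a vertex [z], then reversing the
   loop puts the same node above [z] twice in a cycle of the same length,
   contradicting minimality. *)
have no_cross y : y \in unzip1 r -> y \notin unzip1 d.
  case/mapP=> -[z bz] zr -> /=; apply/negP=> /mapP[[z' bz'] z'd /= zz']; subst z'.
  have bz'E : bz' = ~~ bz.
    move: ud; rewrite /= cat_uniq /= => /and5P[_ _].
    rewrite negb_or => /andP[_ /hasPn/(_ _ z'd) /= zr'] _ _.
    by case: bz bz' zr zr' {z'd} => [] [] // ->.
  subst bz'.
  have: uniq ((x, b) :: rev (map (@flip T) r) ++ (x, ~~ b) :: d).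
    apply: min_c; first by rewrite -sz_d /= !size_cat size_rev size_map.
    by rewrite /bad_cycle !alt_cycle_flip_loop.
  rewrite /= cat_uniq => /and4P[_ _ /hasPn /(_ (z, ~~ bz))].
  rewrite inE z'd orbT mem_rev => /(_ isT) /negP[].
  by apply/mapP; exists (z, bz).
have cyc_d : cycle (alt_step e a) ((x, b) :: r ++ (x, ~~ b) :: d) by case/andP: bad_d.
have := cyc_d; rewrite /= rcons_cat /= -cat_rcons cat_path last_rcons.
case/andP=> path_r path_d.
(* The complementary loop returns to [x], so it too has a first repeated vertex [y], which yields
   the second odd cycle [y :: r2]. *)
have nu2 : ~~ uniq (unzip1 ((x, ~~ b) :: rcons d (x, b))).
  by rewrite /unzip1 /= map_rcons mem_rcons inE eqxx.
have [q2 [[y g] [r2 [[y' g'] [t2 [def_d /= yy' uqr2]]]]]] := first_repetition nu2.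
(* [p0] is the walk from [x] to [y] without its start; it is empty when [y] is [x], the case of two
   cycles sharing a vertex. *)
subst y'; have [p0 def_p0] : exists p0, rcons q2 (y, g) = (x, ~~ b) :: p0.
  case: (q2) def_d => [|u q3] /=; first by case=> -> -> _; exists [::].
  by case=> <- _; exists (rcons q3 (y, g)).
have last_p0 : last (x, ~~ b) p0 = (y, g).
  by rewrite -(last_rcons (x, ~~ b) q2 (y, g)) def_p0.
have {}def_d : rcons d (x, b) = p0 ++ r2 ++ (y, g') :: t2.
  by move: def_d; rewrite -cat_rcons def_p0 => -[].
move: uqr2; rewrite -cat_rcons def_p0 map_cat /= mem_cat negb_or.
case/andP=> /andP[x_p0 x_r2]; rewrite cat_uniq => /and3P[u_p0 /hasPn disj u_r2] .
move: path_d; rewrite def_d -cat_rcons catA !cat_path last_p0 => /andP[/andP[path_p0 path_r2] _].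
have gg' : (y, g) != (y, g').
  have: uniq ((x, ~~ b) :: rcons d (x, b)).
    rewrite -rcons_cons -rot1_cons rot_uniq; apply: subseq_uniq ud.
    by rewrite /= eqxx suffix_subseq.
  rewrite def_d -cat_cons cat_uniq => /and3P[_ /hasPn/(_ (y, g')) yg' _].
  apply: contraTneq (mem_last (x, ~~ b) p0) => ygg'; rewrite last_p0 ygg'.
  by apply: yg'; rewrite mem_cat mem_head orbT.
(* The path and the second loop stay inside [d] and do not come back to [x], so [no_cross] separates
   them from the first loop. *)
have S_d i : i \in unzip1 p0 ++ unzip1 r2 -> (i != x) && (i \in unzip1 d).
  rewrite -map_cat => i_S; have ix : i != x.
    by apply: contraTneq i_S => ->; rewrite map_cat mem_cat negb_or x_p0.
  rewrite ix; case/mapP: i_S => u u_S i_u.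
  have: u \in rcons d (x, b) by rewrite def_d catA mem_cat u_S.
  rewrite mem_rcons inE => /predU1P[u_x | ud']; last by rewrite i_u map_f.
  by rewrite i_u u_x eqxx in ix.
have S_r i : i \in unzip1 p0 ++ unzip1 r2 -> i \notin x :: unzip1 r.
  case/S_d/andP=> ix i_d; rewrite inE negb_or ix.
  by apply: contraL i_d => /no_cross.
have [S_p S_r2] : {subset unzip1 p0 <= unzip1 p0 ++ unzip1 r2}
    /\ {subset unzip1 r2 <= unzip1 p0 ++ unzip1 r2}.
  by split=> i i_in; rewrite mem_cat i_in ?orbT.
have last_p : last x (unzip1 p0) = y by have := last_map fst p0 (x, ~~ b); rewrite last_p0.
have y_r2 : y \notin unzip1 r2.
  apply/negP=> y_r2; have: y \in x :: unzip1 p0 by rewrite -last_p mem_last.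
  rewrite inE => /predU1P[yx | yp0]; first by rewrite -yx y_r2 in x_r2.
  by have /negP[] := disj _ y_r2.
have x_r : x \notin unzip1 r.
  by move: uqr; rewrite map_cat cat_uniq => /and3P[_ _] /= /andP[].
have u_r : uniq (unzip1 r).
  by move: uqr; rewrite map_cat cat_uniq => /and3P[_ _] /= /andP[].
have xbb : (x, b) != (x, ~~ b) by rewrite xpair_eqE eqxx; case: (b).
have /andP[odd1 gt1] := alt_loop_odd path_r xbb.
have /andP[odd2 gt2] := alt_loop_odd path_r2 gg'.
exists (x :: unzip1 r), (y :: unzip1 r2), x, (unzip1 p0); rewrite last_p.
split.
- by rewrite /cycle_seq /= !size_map x_r u_r y_r2 u_r2.
- by rewrite /= x_p0.
- split=> i.
  + rewrite !inE; case: eqP => //= _; apply/andP=> -[i_r /S_p /S_r].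
    by rewrite inE i_r orbT.
  + rewrite [i \in y :: _]inE; case: eqP => [-> | _] /=; first by rewrite -last_p mem_last.
    apply/andP=> -[i_r2]; rewrite inE => /predU1P[ix | i_p0].
      by rewrite -ix i_r2 in x_r2.
    by have /negP[] := disj _ i_r2.
  + rewrite size_map; case: (p0) S_p S_r2 S_r last_p => [|u p1] S_p S_r2 S_r /= => [<- | last_p].
      rewrite !inE; case: eqP => //= _; apply/andP=> -[i_r i_r2].
      by have := S_r i i_r2; rewrite inE i_r orbT.
    apply/andP=> -[i_r]; rewrite inE => /predU1P[i_y | /S_r2/S_r/negP/(_ i_r)//].
    by move: i_r; apply/negP/S_r/S_p; rewrite i_y -last_p mem_last.
- move: (alt_path_edge path_r) (alt_path_edge path_r2) (alt_path_edge path_p0).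
  by rewrite /unzip1 !map_rcons /= => ? ? ?; split.
- move=> v v_in; have: v \in unzip1 ((x, b) :: r ++ (x, ~~ b) :: d).
    have xp_in i : i \in x :: unzip1 p0 -> i \in unzip1 ((x, ~~ b) :: d).
      by rewrite !inE => /predU1P[-> | /S_p/S_d/andP[_ ->]]; rewrite ?eqxx ?orbT.
    rewrite -cat_cons /unzip1 map_cat mem_cat; apply/orP.
    case/or3P: v_in => [? | v_in | /xp_in ?]; [by left | right | by right].
    case/predU1P: v_in => [-> | /S_r2/S_d/andP[_ ?]].
      by apply: xp_in; rewrite -last_p mem_last.
    by rewrite inE; apply/orP; right.
  by case/mapP=> u u_in ->; apply: alt_cycle_cover u_in.
Qed.
End AlternatingCycles.

(** * Subgraphs from alternating cycles *)

Section InjectiveImages.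

Variables (T T' : eqType) (f : T -> T').
Hypothesis f_inj : injective f.

Lemma cycle_seq_map c : cycle_seq (map f c) = cycle_seq c.
Proof. by rewrite /cycle_seq map_inj_uniq // size_map. Qed.

Lemma cycle_edge_map c i j : uniq c ->
  cycle_edge (map f c) (f i) (f j) = cycle_edge c i j.
Proof. by move=> uc; rewrite /cycle_edge !mem_map // !next_map // !inj_eq. Qed.

Lemma infix2_map w i j : infix [:: f i; f j] (map f w) = infix [:: i; j] w.
Proof.
elim: w => [|x w IHw] //; rewrite /= IHw inj_eq //.
by case: w {IHw} => [|y w]; rewrite /= ?inj_eq ?prefix0s.
Qed.

Lemma path_edge_map w i j : path_edge (map f w) (f i) (f j) = path_edge w i j.
Proof. by rewrite /path_edge !infix2_map. Qed.

End InjectiveImages.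

Section EdgeRelations.

Variable T : eqType.
Implicit Types (c w p : seq T) (r : rel T).

Lemma cycle_edge_sym c : symmetric (cycle_edge c).
Proof. by move=> i j; rewrite /cycle_edge andbCA orbC. Qed.

Lemma path_edge_sym w : symmetric (path_edge w).
Proof. by move=> i j; rewrite /path_edge orbC. Qed.

Lemma sub_cycle_edge r c : symmetric r -> cycle r c -> subrel (cycle_edge c) r.
Proof.
move=> r_sym cyc i j /and3P[ic jc /orP[/eqP-> | /eqP->]].
  exact: next_cycle.
by rewrite r_sym next_cycle.
Qed.

Lemma sub_path_edge r x p :
  symmetric r -> path r x p -> subrel (path_edge (x :: p)) r.
Proof.
move=> r_sym pth; have sub i j : infix [:: i; j] (x :: p) -> r i j.
  case/infixP=> -[|y s] [s' /= [xE def_p]]; move: pth; rewrite def_p ?xE.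
    by case/andP.
  by rewrite cat_path /= => /and4P[].
by move=> i j /orP[/sub // | /sub]; rewrite r_sym.
Qed.

Lemma cycle_cycle_edge c : uniq c -> cycle (cycle_edge c) c.
Proof.
move=> uc; have := cycle_next uc; apply: sub_in_cycle (allss c) => i j ic jc.
by move=> /= /eqP <-; rewrite /cycle_edge ic mem_next ic eqxx.
Qed.

Lemma path_path_edge x p : path (path_edge (x :: p)) x p.
Proof.
have: forall s, path (path_edge (s ++ x :: p)) x p; last by move/(_ [::]).
elim: p x => //= y p IHp x s; rewrite -cat_rcons IHp andbT cat_rcons.
by apply/orP; left; apply/infixP; exists s, p.
Qed.

Lemma cycle_edge_next c i : i \in c -> cycle_edge c i (next c i).
Proof. by move=> ic; rewrite /cycle_edge ic mem_next ic eqxx. Qed.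

Lemma path_edge_prev x p i : i \in p -> exists2 j, j \in x :: p & path_edge (x :: p) i j.
Proof.
case/splitPr=> p1 p2; exists (last x p1).
  by rewrite -cat_cons mem_cat mem_last.
apply/orP; right; apply/infixP; exists (belast x p1), p2.
by rewrite -cat_cons lastI cat_rcons.
Qed.

End EdgeRelations.

Definition in_edges n (A : {set {set 'I_n}}) : rel 'I_n :=
  fun i j => [set i; j] \in A.

Lemma in_edges_sym n (A : {set {set 'I_n}}) : symmetric (in_edges A).
Proof. by move=> i j; rewrite /in_edges finset.setUC. Qed.

Lemma edgeE n (G : graph n) i j : ([set i; j] \in edges G) = adj G i j.
Proof.
rewrite inE; apply/existsP/idP => [[x /existsP[y /andP[xy /eqP E]]] | ij]; last first.
  by exists i; apply/existsP; exists j; rewrite ij /=.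
have ne : x != y by apply: contraTneq xy => ->; rewrite adj_irrefl.
have: x \in [set i; j] by rewrite E set21.
have: y \in [set i; j] by rewrite E set22.
have: i \in [set x; y] by rewrite -E set21.
rewrite !inE; case/orP=> /eqP-> /orP[] /eqP E1 /orP[] /eqP E2; subst => //.
- by rewrite eqxx in ne.
- by rewrite eqxx in ne.
- by rewrite adj_sym.
Qed.

Lemma edgeP n (G : graph n) e :
  reflect (exists i j, adj G i j /\ e = [set i; j]) (e \in edges G).
Proof.
rewrite inE; apply: (iffP existsP) => [[i /existsP[j /andP[ij /eqP->]]] | [i [j [ij ->]]]].
  by exists i, j.
by exists i; apply/existsP; exists j; rewrite ij /=.
Qed.

Lemma sub_in_edges n (G : graph n) (A : {set {set 'I_n}}) :
  A \subset edges G -> subrel (in_edges A) (adj G).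
Proof. by move=> /fintype.subsetP sA i j /sA; rewrite edgeE. Qed.

Definition edge_walk n (G : graph n) (A : {set {set 'I_n}}) := alt_step (adj G) (in_edges A).

(* By Farkas duality this expresses that [A] is the set of vertices of a face. *)
Definition alt_closed n (G : graph n) (A : {set {set 'I_n}}) :=
  forall i j, adj G i j -> connect (edge_walk G A) (j, true) (i, false) ->
    [set i; j] \in A.

(** A [graph] lives on an ordinal, so the vertices in [V] are renumbered by [enum_val]; the last
    hypothesis rules out isolated vertices. *)
Lemma exists_subgraph n (G : graph n) (V : {set 'I_n}) (E : rel 'I_n) :
  symmetric E -> subrel E (adj G) ->
  (forall i, i \in V -> exists2 j, j \in V & E i j) ->
  exists2 H : graph #|V|, contains G H &
    forall i j : 'I_#|V|, adj H i j = E (enum_val i) (enum_val j).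
Proof.
move=> E_sym E_sub E_V; pose r : rel 'I_#|V| := relpre enum_val E.
have r_sym : symmetric r by move=> i j; exact: E_sym.
have r_irr : irreflexive r.
  by move=> i; apply/negP=> /E_sub; rewrite adj_irrefl.
have r_iso i : exists j, r i j.
  have [j jV ij] := E_V _ (enum_valP i).
  by exists (enum_rank_in jV j); rewrite /r /= enum_rankK_in.
exists (Graph r_sym r_irr r_iso) => //; exists enum_val; first exact: enum_val_inj.
by move=> i j /E_sub.
Qed.

Lemma enum_val_seq (T : finType) (V : {set T}) s :
  {subset s <= V} -> exists s', s = map (@enum_val _ (mem V)) s'.
Proof.
elim: s => [|x s IHs] sV; first by exists [::].
have [|s' ->] := IHs; first by move=> y ys; apply: sV; rewrite inE ys orbT.
have xV : x \in V by apply: sV; rewrite mem_head.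
by exists (enum_rank_in xV x :: s'); rewrite /= enum_rankK_in.
Qed.

Lemma card_edge_cover n (G : graph n) (A : {set {set 'I_n}}) (V : {set 'I_n}) :
  A \subset edges G -> (forall i, i \in V -> exists j, in_edges A i j) ->
  #|V| <= 2 * #|A|.
Proof.
move=> /fintype.subsetP sA covV; apply: (@leq_trans #|finset.cover A|).
  apply/subset_leq_card/fintype.subsetP=> i /covV[j ijA].
  by apply/finset.bigcupP; exists [set i; j]; rewrite ?set21.
apply: leq_trans (leq_card_cover A).1 _; rewrite mulnC -sum_nat_const.
apply: leq_sum => e /sA/edgeP[i [j [_ ->]]]; rewrite cards2; by case: eqP.
Qed.

Lemma contains_even_cycle n (G : graph n) C :
  cycle_seq C -> ~~ odd (size C) -> cycle (adj G) C ->
  exists2 H : graph #|[set i in C]|, contains G H & even_cycle H.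
Proof.
move=> cC eC cyc; set V := [set i in C].
have [|||H GH adjH] := @exists_subgraph _ G V (cycle_edge C).
- exact: cycle_edge_sym.
- by apply: sub_cycle_edge => //; apply: adj_sym.
- move=> i; rewrite inE => iC; exists (next C i); last exact: cycle_edge_next.
  by rewrite inE mem_next.
exists H => //; have [|c defC] := @enum_val_seq _ V C; first by move=> i; rewrite inE.
have inj := @enum_val_inj _ (mem V).
exists c; split.
- by rewrite defC cycle_seq_map in cC.
- by rewrite defC size_map in eC.
- by move=> i; rewrite -(mem_map inj) -defC; have := enum_valP i; rewrite inE.
- move=> i j; rewrite adjH defC cycle_edge_map //.
  by move: cC; rewrite defC cycle_seq_map // => /andP[].
Qed.

Lemma contains_joined_odd_cycles n (G : graph n) C1 C2 x p :
  [/\ cycle_seq C1, odd (size C1), cycle_seq C2 & odd (size C2)] ->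
  uniq (x :: p) ->
  [/\ forall i, (i \in C1) && (i \in x :: p) = (i == x),
      forall i, (i \in C2) && (i \in x :: p) = (i == last x p)
    & forall i, (i \in C1) && (i \in C2) = (size p == 0) && (i == x)] ->
  [/\ cycle (adj G) C1, cycle (adj G) C2 & path (adj G) x p] ->
  exists2 H : graph #|[set i | [|| i \in C1, i \in C2 | i \in x :: p]]|,
    contains G H & joined_odd_cycles H.
Proof.
move=> [cC1 oC1 cC2 oC2] up [dis1 dis2 dis3] [cyc1 cyc2 pth].
set V := finset _.
pose E i j := [|| cycle_edge C1 i j, cycle_edge C2 i j | path_edge (x :: p) i j].
have [|||H GH adjH] := @exists_subgraph _ G V E.
- by move=> i j; rewrite /E !(cycle_edge_sym _ i) path_edge_sym.
- move=> i j /or3P[]; first by apply: sub_cycle_edge => //; apply: adj_sym.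
    by apply: sub_cycle_edge => //; apply: adj_sym.
  by apply: sub_path_edge => //; apply: adj_sym.
- have C1_V i : i \in C1 -> exists2 j, j \in V & E i j.
    move=> iC; exists (next C1 i); first by rewrite inE mem_next iC.
    by rewrite /E cycle_edge_next.
  move=> i; rewrite inE => /or3P[/C1_V // | iC | ].
    exists (next C2 i); first by rewrite inE mem_next iC orbT.
    by rewrite /E cycle_edge_next ?orbT.
  case/predU1P=> [-> | /(path_edge_prev x)[j jp ij]].
    by apply: C1_V; have := dis1 x; rewrite eqxx => /andP[].
  by exists j; rewrite ?[j \in V]inE /E ?jp ?ij !orbT.
exists H => //; have inj := @enum_val_inj _ (mem V).
have [|c1 def1] := @enum_val_seq _ V C1; first by move=> i; rewrite inE => ->.
have [|c2 def2] := @enum_val_seq _ V C2.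
  by move=> i iC; rewrite inE iC orbT.
have [|[|y w] // [defx defp]] := @enum_val_seq _ V (x :: p).
  by move=> i ip; rewrite [i \in V]inE ip !orbT.
have defxp : x :: p = map enum_val (y :: w) by rewrite defx defp.
have uniq1 : uniq c1 by move: cC1; rewrite def1 cycle_seq_map // => /andP[].
have uniq2 : uniq c2 by move: cC2; rewrite def2 cycle_seq_map // => /andP[].
exists c1, c2, y, w; split.
- by move: cC1 oC1; rewrite def1 size_map cycle_seq_map // => -> ->.
- by move: cC2 oC2; rewrite def2 size_map cycle_seq_map // => -> ->.
- by rewrite -(map_inj_uniq inj) -defxp.
- split=> i.
  + by have := dis1 (enum_val i); rewrite defxp def1 !mem_map // defx inj_eq.
  + by have := dis2 (enum_val i); rewrite defxp def2 !mem_map // defx defp last_map inj_eq.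
  + by have := dis3 (enum_val i); rewrite def1 def2 !mem_map // defx defp size_map inj_eq.
- split=> [i | i j].
    by rewrite -!(mem_map inj) -def1 -def2 -defxp; have := enum_valP i; rewrite inE.
  by rewrite adjH /E def1 def2 defxp !cycle_edge_map // path_edge_map.
Qed.

Lemma F_free_alt_closed k n (G : graph n) (A : {set {set 'I_n}}) :
  A \subset edges G -> #|A| <= k -> F_free k G -> alt_closed G A.
Proof.
move=> sA Ak free i j ij /connectP[p pth last_p]; apply: contraT => ijA.
have sAG := sub_in_edges sA.
(* The step from [(i, false)] to [(j, true)] along an edge outside [A] closes the walk to a bad
   cycle. *)
have bad : bad_cycle (adj G) (in_edges A) ((j, true) :: p).
  rewrite /bad_cycle /= !rcons_path pth -last_p /alt_step /= ij /=.
  by rewrite /in_edges (negPf ijA) andbF.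
have leV (V : {set 'I_n}) : (forall i, i \in V -> exists j, in_edges A i j) -> #|V| <= 2 * k.
  by move/(card_edge_cover sA)/leq_trans; apply; rewrite leq_mul2l.
have := bad_cycle_extract (@adj_sym _ G) (@in_edges_sym _ A) (@adj_irrefl _ G) sAG bad.
case=> [[C [/andP[cC eC] cyc cov]] | [C1 [C2 [x [q [cs uq dis cycs cov]]]]]].
  have [H GH evenH] := contains_even_cycle cC eC cyc.
  case: (free _ H _ GH); split; last by left.
  by apply: leV => u; rewrite inE => /cov.
have [H GH joinH] := contains_joined_odd_cycles cs uq dis cycs.
case: (free _ H _ GH); split; last by right.
by apply: leV => u; rewrite inE => /cov.
Qed.

(** * Alternating walks in even cycles and joined odd cycles *)

Section AlternateEdges.

Variable T : finType.

(** These are the edges that a set [A] must contain for the walk along [x :: s], started with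
    boolean [b], to be alternating. *)
Fixpoint alt_edges (b : bool) (x : T) (s : seq T) : seq {set T} :=
  if s is y :: s' then
    if b then [set x; y] :: alt_edges (~~ b) y s' else alt_edges (~~ b) y s'
  else [::].

Lemma size_alt_edges b x s : size (alt_edges b x s) = (b + size s)./2.
Proof. by elim: s b x => [|y s IHs] [] x //=; rewrite IHs. Qed.

Lemma alt_edges_cat b x s1 s2 :
  alt_edges b x (s1 ++ s2) =
  alt_edges b x s1 ++ alt_edges (b (+) odd (size s1)) (last x s1) s2.
Proof.
elim: s1 b x => [|y s1 IHs] b x /=; first by rewrite addbF.
by rewrite IHs addNb addbN; case: b.
Qed.

Lemma alt_edges_sub b x s e : e \in alt_edges b x s -> {subset e <= x :: s}.
Proof.
elim: s b x => [|y s IHs] [] x //=; last first.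
  by move/IHs=> sub v /sub vs; rewrite inE vs orbT.
rewrite inE => /orP[/eqP-> | /IHs sub] v; last by move/sub=> vs; rewrite inE vs orbT.
by rewrite !inE orbA => ->.
Qed.

End AlternateEdges.

Lemma connect_flip (T : finType) (e a : rel T) u v :
  symmetric e -> symmetric a ->
  connect (alt_step e a) u v -> connect (alt_step e a) (flip v) (flip u).
Proof.
move=> e_sym a_sym /connectP[p pth ->]; elim: p u pth => //= w p IHp u.
case/andP=> uw /IHp/connect_trans; apply; apply: connect1.
by rewrite alt_step_flip.
Qed.

Section AlternateEdgesOfGraph.

Variables (n : nat) (G : graph n).

Lemma alt_edges_edges b x s e :
  path (adj G) x s -> e \in alt_edges b x s -> e \in edges G.
Proof.
elim: s b x => [|y s IHs] [] x //= /andP[xy pth]; last exact: IHs pth.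
by rewrite inE => /orP[/eqP-> | /(IHs _ _ pth)//]; rewrite edgeE.
Qed.

Lemma connect_alt_edges (A : {set {set 'I_n}}) b x s :
  path (adj G) x s -> {subset alt_edges b x s <= A} ->
  connect (edge_walk G A) (x, b) (last x s, b (+) odd (size s)).
Proof.
elim: s b x => [|y s IHs] b x /=; first by rewrite addbF.
case/andP=> xy pth sA; rewrite addbN -addNb.
apply: connect_trans (IHs (~~ b) y pth _).
  apply: connect1; rewrite /edge_walk /alt_step /= eqxx /=.
  by case: b sA => // sA; apply: sA; rewrite mem_head.
by case: b sA => // sA e eA; apply: sA; rewrite inE eA orbT.
Qed.

(** The walk never returns to [z], so only its first edge contains [z], and that edge leads to [u]
    rather than [a]. *)
Lemma start_notin_alt_edges a z u s :
  adj G a z -> z \notin u :: s -> u != a ->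
  [set a; z] \notin alt_edges true z (u :: s).
Proof.
move=> az zs ua; rewrite /= inE negb_or; apply/andP; split; last first.
  by apply: contra zs => /alt_edges_sub; apply; rewrite set22.
apply: contraTneq (set21 a z) => ->; rewrite !inE negb_or eq_sym.
by rewrite (eq_sym a) ua andbT; apply: contraTneq az => ->; rewrite adj_irrefl.
Qed.

Variable k : nat.
Hypothesis closedG : forall A : {set {set 'I_n}},
  A \subset edges G -> #|A| <= k -> alt_closed G A.

(** Half of [1 + 2 * k], rounded down, is [k], so [A] is small enough to be closed; a connection
    would then force the edge from [a] to [z] into [A]. *)
Lemma alternate_edges_disconnect a z u s (A := [set e in alt_edges true z (u :: s)]) :
  adj G a z -> path (adj G) z (u :: s) -> z \notin u :: s -> u != a ->
  size (u :: s) <= 2 * k -> ~ connect (edge_walk G A) (z, true) (a, false).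
Proof.
move=> az pth zs ua sz conn; have/negP[] := start_notin_alt_edges az zs ua.
have -> : ([set a; z] \in alt_edges true z (u :: s)) = ([set a; z] \in A).
  by rewrite [RHS]inE.
apply: (closedG _ _ az conn).
  by apply/fintype.subsetP=> e; rewrite [_ \in A]inE; apply: alt_edges_edges.
rewrite cardsE; apply: leq_trans (card_size _) _; rewrite size_alt_edges.
by move: (size _) sz => j; lia.
Qed.

(** Without the edge from [a] to [z], the cycle is a walk from [z] to [a] with an odd number of
    steps, so it leads from [true] to [false]. *)
Lemma no_short_even_cycle c :
  cycle_seq c -> ~~ odd (size c) -> cycle (adj G) c -> 2 * k < size c.
Proof.
case/andP; case: c => [|a [|z [|u s]]] //= uc _ even_c cyc; rewrite ltnNge.
apply/negP=> sz; have [az pth] : adj G a z /\ path (adj G) z (u :: rcons s a).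
  by case/andP: cyc.
apply: (@alternate_edges_disconnect a z u (rcons s a)) => //.
- move: uc; rewrite /= !inE mem_rcons inE !negb_or.
  by case/and3P=> /and3P[az' _ _] /andP[-> ->] _; rewrite eq_sym az'.
- by move: uc; rewrite /= !inE !negb_or => /andP[/and3P[_ au _] _]; rewrite eq_sym.
- by rewrite /= size_rcons; lia.
have -> : (a, false) = (last z (u :: rcons s a), true (+) odd (size (u :: rcons s a))).
  by rewrite /= last_rcons size_rcons; congr (_, _); move: even_c => /=; case: (odd _).
by apply: connect_alt_edges => // e; rewrite [_ \in finset _]inE.
Qed.

(* Starting from [z], walk around the first odd cycle to [a], along [p] to [y]
   and around the second cycle back to [y]; the way back from [y] to [a] reverses
   [p], hence uses no new edge of [A]. *)
Lemma no_short_joined_odd_cycles a d p y d2 :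
  cycle (adj G) (a :: d) -> cycle (adj G) (y :: d2) -> path (adj G) a p ->
  last a p = y -> uniq (d ++ (a :: p) ++ d2) -> 1 < size d ->
  ~~ odd (size d) -> ~~ odd (size d2) -> 2 * k < size (d ++ (a :: p) ++ d2).
Proof.
case: d => [|z [|u d]] // cyc1 cyc2 pth last_p ul _ even1 even2.
rewrite ltnNge; apply/negP=> sz.
have [az pth1] : adj G a z /\ path (adj G) z (rcons (u :: d) a) by case/andP: cyc1.
set s := rcons d a ++ p ++ rcons d2 y.
have last1 : last z (rcons (u :: d) a) = a by rewrite last_rcons.
have path_s : path (adj G) z (u :: s).
  by rewrite -!cat_cons cat_path -rcons_cons pth1 last1 cat_path pth last_p.
apply: (@alternate_edges_disconnect a z u s) => //.
- have: z \notin u :: d ++ (a :: p) ++ d2 by case/andP: ul.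
  have y_ap: y \in a :: p by rewrite -last_p mem_last.
  apply: contra; rewrite /s !(inE, mem_cat, mem_rcons).
  case: (z =P y) => [-> _ | _].
    by move: y_ap; rewrite inE; case/orP=> yE; rewrite yE !orbT.
  by case: (z == u); case: (z == a); case: (z \in d); case: (z \in p).
- apply: contraTneq ul => ->.
  by rewrite /= [a \in _]mem_cat mem_head orbT andbF.
(* The walk has as many steps as there are listed vertices: the start [z] is not counted, but [y] is
   reached once more at the end. *)
- by move: sz; rewrite /s /= !size_cat /= !size_cat !size_rcons; lia.
set A := finset _.
have sA : {subset alt_edges true z (u :: s) <= A}.
  by move=> e; rewrite [_ \in A]inE.
pose g := odd (size p).
have [A1 [A2 A3]] : {subset alt_edges true z (rcons (u :: d) a) <= A} /\
   ({subset alt_edges true a p <= A} /\ {subset alt_edges (~~ g) y (rcons d2 y) <= A}).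
  have defs : u :: s = rcons (u :: d) a ++ p ++ rcons d2 y by [].
  have odd1 : odd (size (rcons (u :: d) a)) = false.
    by rewrite size_rcons /=; apply: negbTE.
  move: sA; rewrite defs !alt_edges_cat odd1 last1 last_p addbF addTb => sA.
  by split; [|split] => e eA; apply: sA; rewrite !mem_cat eA ?orbT.
have c1 := connect_alt_edges pth1 A1.
have c2 := connect_alt_edges pth A2.
have c3 := connect_alt_edges cyc2 A3.
(* The path ends at [(y, ~~ g)] and the second odd cycle leads from there to [(y, g)], exactly where
   the reversed path starts; it ends at [(a, false)]. *)
have c4 := connect_flip (@adj_sym _ G) (@in_edges_sym _ A) c2.
rewrite last1 size_rcons /= in c1; rewrite last_p /flip /= in c2 c4.
rewrite last_rcons size_rcons /= in c3.
apply: connect_trans (connect_trans (connect_trans c2 _) c4).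
  by move: c1 even1; rewrite /=; case: (odd _).
by move: c3 even2; rewrite /g; case: (odd (size d2)); case: (odd (size p)).
Qed.

End AlternateEdgesOfGraph.

Lemma alt_closed_F_free k n (G : graph n) :
  (forall A : {set {set 'I_n}}, A \subset edges G -> #|A| <= k -> alt_closed G A) ->
  F_free k G.
Proof.
move=> closedG m H [mk famH] [f f_inj fH].
have sz_uniq (s : seq 'I_m) : uniq s -> size s <= 2 * k.
  by move/card_uniqP=> <-; apply: leq_trans (max_card _) _; rewrite card_ord.
have cyc_map c : cycle (adj H) c -> cycle (adj G) (map f c).
  exact: homo_cycle.
case: famH => [[c [cc ec _ adjH]] | [c1 [c2 [x [p [cs1 cs2 up [dis1 dis2 dis3] [_ adjH]]]]]]].
  have uc : uniq c by case/andP: cc.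
  have := @no_short_even_cycle _ _ _ closedG (map f c).
  rewrite cycle_seq_map // size_map => /(_ cc ec); rewrite ltnNge sz_uniq //.
  case/(_ _)/negP => //; apply: cyc_map; rewrite (eq_cycle adjH).
  exact: cycle_cycle_edge.
case/andP: cs1 => /andP[u1 gt1] odd1; case/andP: cs2 => /andP[u2 _] odd2.
have /andP[xc1 _] : (x \in c1) && (x \in x :: p) by rewrite dis1.
have /andP[yc2 _] : (last x p \in c2) && (last x p \in x :: p) by rewrite dis2.
have cyc1 : cycle (adj H) c1.
  apply: sub_cycle (cycle_cycle_edge u1) => i j ij.
  by rewrite adjH ij.
have cyc2 : cycle (adj H) c2.
  apply: sub_cycle (cycle_cycle_edge u2) => i j ij.
  by rewrite adjH ij orbT.
have pth : path (adj H) x p.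
  apply: sub_path (path_path_edge x p) => i j ij.
  by rewrite adjH ij !orbT.
(* The cycles are rotated to begin at the ends of the path, so that [d1], [x :: p] and [d2] together
   list no vertex twice. *)
have [i1 d1 def1] := rot_to xc1; have [i2 d2 def2] := rot_to yc2.
have mem1 i : (i \in c1) = (i \in x :: d1) by rewrite -def1 mem_rot.
have mem2 i : (i \in c2) = (i \in last x p :: d2) by rewrite -def2 mem_rot.
have size1 : size c1 = (size d1).+1 by rewrite -(size_rot i1) def1.
have size2 : size c2 = (size d2).+1 by rewrite -(size_rot i2) def2.
have {u1} /= /andP[xd1 ud1] : uniq (x :: d1) by rewrite -def1 rot_uniq.
have {u2} /= /andP[yd2 ud2] : uniq (last x p :: d2) by rewrite -def2 rot_uniq.
have {}cyc1 : cycle (adj H) (x :: d1) by rewrite -def1 rot_cycle.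
have {}cyc2 : cycle (adj H) (last x p :: d2) by rewrite -def2 rot_cycle.
have ul : uniq (d1 ++ (x :: p) ++ d2).
  have d1p i : i \in d1 -> i \notin x :: p.
    move=> id; apply/negP=> ip; have := dis1 i; rewrite mem1 ip inE id orbT.
    by case: eqP => // ix; rewrite -ix id in xd1.
  have d2p i : i \in d2 -> i \notin x :: p.
    move=> id; apply/negP=> ip; have := dis2 i; rewrite mem2 ip inE id orbT.
    by case: eqP => // ix; rewrite -ix id in yd2.
  have d12 i : i \in d1 -> i \notin d2.
    move=> id; apply/negP=> ip; have := dis3 i; rewrite mem1 mem2 !inE ip id !orbT.
    by case: (i =P x); rewrite ?andbF // => ix; rewrite -ix id in xd1.
  rewrite cat_uniq ud1 cat_uniq up ud2 !andbT !andTb; apply/andP; split.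
    apply/hasPn=> i; rewrite mem_cat => /orP[ip | id2].
      by apply: contraL ip => /d1p.
    by apply: contraL id2 => /d12.
  by apply/hasPn=> i /d2p.
have := @no_short_joined_odd_cycles _ _ _ closedG (f x) (map f d1) (map f p)
  (f (last x p)) (map f d2).
rewrite -!(map_cons f) -!map_cat size_map !(size_map f) map_inj_uniq // last_map.
move=> no; have := sz_uniq _ ul; rewrite leqNgt => /negP[]; apply: no => //.
- exact: cyc_map (x :: d1) cyc1.
- exact: cyc_map (_ :: d2) cyc2.
- exact: homo_path pth.
- by rewrite size1 in gt1.
- by rewrite size1 in odd1.
- by rewrite size2 in odd2.
Qed.

(** * Faces of the edge polytope *)

Section Faces.

Local Open Scope ring_scope.
Local Open Scope classical_set_scope.
Variables (R : realType) (n : nat).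
Implicit Types (c x v : 'rV[R]_n) (S P F : set 'rV[R]_n).

Definition dot c x : R := \sum_(i < n) c 0 i * x 0 i.

Lemma dot_comb c m (l : 'I_m -> R) (a : 'I_m -> 'rV[R]_n) :
  dot c (\sum_i l i *: a i) = \sum_i l i * dot c (a i).
Proof.
rewrite /dot; under eq_bigr => i _.
  rewrite summxE mulr_sumr; under eq_bigr => j _ do rewrite mxE mulrCA.
  over.
by rewrite exchange_big; apply: eq_bigr => i _; rewrite mulr_sumr.
Qed.

Lemma sub_conv S : S `<=` conv S.
Proof.
move=> x Sx; exists 1, (fun=> x), (fun=> 1).
by split; rewrite ?big_ord1 ?scale1r // => i; apply: ler01.
Qed.

Lemma conv_dot_le S c b :
  (forall x, S x -> dot c x <= b) -> forall x, conv S x -> dot c x <= b.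
Proof.
move=> Sb x [m [a [l [Sa l_ge0 l1 ->]]]]; rewrite dot_comb -[b]mul1r -l1 mulr_suml.
by apply: ler_sum => i _; rewrite ler_wpM2l // Sb.
Qed.

(** The nonnegative terms [l j * (b - dot c (a j))] sum to zero, so each of them vanishes. *)
Lemma comb_max_support m (l : 'I_m -> R) (a : 'I_m -> 'rV[R]_n) c b :
  (forall i, 0 <= l i) -> \sum_i l i = 1 ->
  (forall i, l i != 0 -> dot c (a i) <= b) -> dot c (\sum_i l i *: a i) = b ->
  forall i, l i != 0 -> dot c (a i) = b.
Proof.
move=> l_ge0 l1 le_b eq_b i li.
have ge0 j : true -> 0 <= l j * (b - dot c (a j)).
  have [-> | lj] := eqVneq (l j) 0; first by rewrite mul0r.
  by rewrite mulr_ge0 // subr_ge0 le_b.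
have sum0 : \sum_j l j * (b - dot c (a j)) = 0.
  under eq_bigr => j _ do rewrite mulrBr.
  by rewrite sumrB -mulr_suml l1 mul1r -dot_comb eq_b subrr.
have /eqP := @psumr_eq0P _ _ predT _ ge0 sum0 i isT.
by rewrite mulf_eq0 (negPf li) /= subr_eq0 => /eqP.
Qed.

Lemma comb_support m (l : 'I_m -> R) : \sum_i l i = 1 -> exists i, l i != 0.
Proof.
move=> l1; apply/existsP; apply: contraT; rewrite negb_exists => /forallP l0.
move: l1; rewrite big1 => [/esym/eqP | i _]; first by rewrite oner_eq0.
by apply/eqP; have := l0 i; rewrite negbK.
Qed.

(** In a convex combination equal to [v], every generator with nonzero coefficient attains both
    maxima, hence equals [v]. *)
Lemma vertex_face_gen S F v : face (conv S) F -> face F [set v] -> S v.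
Proof.
move=> [c [b [le_b ->]]] [c' [b' [le_b' defv]]].
have [[Pv cv] c'v] : ((conv S `&` [set x | dot c x = b]) `&` [set x | dot c' x = b']) v.
  by rewrite -[X in X v]defv.
case: Pv cv c'v => m [a [l [Sa l_ge0 l1 defv']]] /= cv c'v; rewrite defv' in cv c'v.
have [i li] := comb_support l1.
have a_c j : l j != 0 -> dot c (a j) = b.
  by apply: comb_max_support cv _ => // ? _; apply/le_b/sub_conv.
have a_c' j : l j != 0 -> dot c' (a j) = b'.
  apply: comb_max_support c'v _ => // ? ?; apply: le_b'; split; last exact: a_c.
  exact: sub_conv.
suff <- : a i = v by [].
suff : [set v] (a i) by [].
rewrite defv; split; last exact: a_c'.
by split; [exact: sub_conv | exact: a_c].
Qed.

Lemma face_mem P v : face P [set v] -> P v.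
Proof.
by move=> [c [b [_ defv]]]; have: [set v] v by []; rewrite [X in X v -> _]defv => -[].
Qed.

Lemma face_sub_vertex P F v : face P F -> face P [set v] -> F v -> face F [set v].
Proof.
move=> [c [b [_ ->]]] [c' [b' [le_b' defv]]] Fv; exists c', b'; split.
  by move=> x [Px _]; apply: le_b'.
apply/seteqP; split=> [_ -> | x [[Px _] cx]].
  by split=> //; have: [set v] v by []; rewrite [X in X v -> _]defv => -[].
by rewrite defv; split.
Qed.

Lemma face_refl P : face P P.
Proof.
exists 0, 0; split=> [x _ | ]; first by rewrite big1 // => i _; rewrite mxE mul0r.
by apply/seteqP; split=> [x Px | x []//]; split=> //=; rewrite big1 // => i _; rewrite mxE mul0r.
Qed.

(** For an edge this is the sum of two unit vectors; indexing by sets makes it injective. *)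
Definition edge_vec (e : {set 'I_n}) : 'rV[R]_n := \row_i (i \in e)%:R.

Lemma edge_vec_inj : injective edge_vec.
Proof.
move=> e e' /rowP E; apply/setP=> i; have /eqP := E i; rewrite !mxE.
by case: (i \in e); case: (i \in e'); rewrite // ?oner_eq0 // eq_sym oner_eq0.
Qed.

Lemma dot_edge_vec c i j : i != j -> dot c (edge_vec [set i; j]) = c 0 i + c 0 j.
Proof.
move=> ij; rewrite /dot (bigD1 i) // (bigD1 j) 1?eq_sym //= !mxE set21 set22 !mulr1.
rewrite big1 ?addr0 // => l /andP[li lj].
by rewrite mxE !inE (negPf li) (negPf lj) mulr0.
Qed.

Lemma card_edge_vec (A : {set {set 'I_n}}) : ([set edge_vec e | e in [set` A]] #= `I_#|A|)%card.
Proof.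
pose f i := edge_vec (nth finset.set0 (enum A) i).
have -> : [set edge_vec e | e in [set` A]] = f @` `I_#|A|.
  apply/seteqP; split=> [_ [e eA <-] | _ [i iA <-]].
    have eA' : e \in enum A by rewrite mem_enum.
    by exists (index e (enum A)); rewrite /f ?nth_index //= cardE index_mem.
  exists (nth finset.set0 (enum A) i) => //=.
  by rewrite -mem_enum mem_nth // -cardE.
apply: inj_card_eq => i j /set_mem /= iA /set_mem /= jA /edge_vec_inj/eqP.
by rewrite nth_uniq ?enum_uniq -?cardE // => /eqP.
Qed.

Variable G : graph n.

Lemma edge_neq i j : adj G i j -> i != j.
Proof. by apply: contraTneq => ->; rewrite adj_irrefl. Qed.

Definition edge_points : set 'rV[R]_n := [set edge_vec e | e in [set` edges G]].

Lemma edge_polytopeE : edge_polytope R G = conv edge_points.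
Proof.
rewrite /edge_polytope; congr conv.
have E i j : i != j -> edge_vec [set i; j] = delta_mx 0 i + delta_mx 0 j.
  move=> ij; apply/rowP=> l; rewrite !mxE !inE !eqxx /=.
  by case: (l =P i) => [-> | _]; rewrite /= ?(negPf ij) ?addr0 ?add0r.
apply/seteqP; split=> [_ [i [j [ij ->]]] | _ [e /edgeP[i [j [ij ->]]] <-]].
  by exists [set i; j]%SET; rewrite /= ?edgeE ?E ?edge_neq.
by exists i, j; rewrite E ?edge_neq.
Qed.

(** The product counts the common ends of the two edges. *)
Lemma dot_edge_vec2 e e' : e \in edges G -> e' \in edges G ->
  dot (edge_vec e) (edge_vec e') <= 2 ?= iff (e == e').
Proof.
move=> /edgeP[i [j [ij ->]]] /edgeP[i' [j' [ij' ->]]].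
rewrite dot_edge_vec ?edge_neq // !mxE -natrD; apply/leifP.
have ne' := edge_neq ij'; case: eqP => [-> | ne].
  by rewrite set21 set22.
rewrite ltr_nat; case i'e: (i' \in _); case j'e: (j' \in _) => //=.
case: ne; apply/eqP; rewrite eq_sym eqEcard !cards2 ne' (edge_neq ij) leqnn andbT.
by apply/fintype.subsetP=> l /finset.set2P[] ->.
Qed.

(** The edge vector itself serves as functional: among the generators, its maximum 2 is attained
    only at [e]. *)
Lemma edge_vec_vertex e : e \in edges G -> vertices (edge_polytope R G) (edge_vec e).
Proof.
rewrite edge_polytopeE => eG; have le2 x : edge_points x -> dot (edge_vec e) x <= 2.
  by case=> e' e'G <-; apply: (dot_edge_vec2 eG e'G).1.
have Pe : conv edge_points (edge_vec e) by apply: sub_conv; exists e.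
exists (edge_vec e), 2; split; first exact: conv_dot_le.
apply/seteqP; split=> [_ -> | x [[m [a [l [Sa l_ge0 l1 ->]]]] /= ax]].
  by split=> //=; apply/eqP; rewrite -/(dot _ _) (dot_edge_vec2 eG eG).2.
have aE i : l i != 0 -> a i = edge_vec e.
  move=> li; have := comb_max_support l_ge0 l1 (fun i _ => le2 _ (Sa i)) ax li.
  have [e' e'G <-] := Sa i.
  by move/eqP; rewrite (dot_edge_vec2 eG e'G).2 => /eqP ->.
rewrite -[RHS]scale1r -l1 scaler_suml; apply: eq_bigr => i _.
by have [-> | /aE->] := eqVneq (l i) 0; rewrite ?scale0r.
Qed.

Lemma vertices_edge_polytope v : vertices (edge_polytope R G) v -> edge_points v.
Proof. by rewrite edge_polytopeE; apply: vertex_face_gen (face_refl _). Qed.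

End Faces.

(** * Potentials and alternating walks *)

Section Potentials.

Local Open Scope ring_scope.
Variables (R : realType) (n : nat) (G : graph n) (A : {set {set 'I_n}}).

(** With value [c 0 i] at [(i, true)] and its negative at [(i, false)], an [adj G] step cannot
    increase the value and an [A] step preserves it. *)
Lemma walk_potential (c : 'rV[R]_n) u v :
  (forall i j, adj G i j -> c 0 i + c 0 j <= 0) ->
  (forall i j, [set i; j]%SET \in A -> c 0 i + c 0 j = 0) ->
  connect (edge_walk G A) u v ->
  (if v.2 then c 0 v.1 else - c 0 v.1) <= (if u.2 then c 0 u.1 else - c 0 u.1).
Proof.
move=> c_le c_eq /connectP[p pth ->]; elim: p u pth => //= w p IHp u.
case/andP=> /andP[/eqP w2 uw] /IHp/le_trans; apply; rewrite w2.
case: u.2 uw => /= [/c_eq/eqP | /c_le]; first by rewrite addr_eq0 => /eqP->; rewrite ?lexx.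
by rewrite -lerBrDl sub0r.
Qed.

Lemma exists_potential : alt_closed G A ->
  exists c : 'rV[R]_n, forall i j, adj G i j ->
    c 0 i + c 0 j <= 0 ?= iff ([set i; j]%SET \in A).
Proof.
move=> closedA; pose D := edge_walk G A.
pose rk u := #|[pred v | connect D u v]|.
have rk_le u v : connect D u v -> (rk v <= rk u)%N.
  by move=> uv; apply/subset_leq_card/fintype.subsetP=> w; apply: connect_trans uv.
have rk_eq u v : connect D u v -> rk v = rk u -> connect D v u.
  move=> uv eq_rk; have: [pred w | connect D v w] =i [pred w | connect D u w].
    apply/subset_cardP=> //; apply/fintype.subsetP=> w; exact: connect_trans uv.
  by move/(_ u); rewrite !inE connect0.
(* The number of nodes reachable from a node does not increase along a walk;
   antisymmetrizing it in the boolean gives the potential. *)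
exists (\row_i ((rk (i, true))%:R - (rk (i, false))%:R)) => i j ij; rewrite !mxE.
have ij1 : connect D (i, false) (j, true) by apply: connect1; rewrite /D /edge_walk /alt_step /=.
have ji1 : connect D (j, false) (i, true).
  by apply: connect1; rewrite /D /edge_walk /alt_step /= adj_sym.
have le1 := rk_le _ _ ij1; have le2 := rk_le _ _ ji1.
rewrite addrACA -opprD -!natrD; apply/leifP; case: ifP => ijA.
  have ij2 : connect D (i, true) (j, false) by apply: connect1; rewrite /D /edge_walk /alt_step /=.
  have ji2 : connect D (j, true) (i, false).
    by apply: connect1; rewrite /D /edge_walk /alt_step /= in_edges_sym.
  have := rk_le _ _ ij2; have := rk_le _ _ ji2 => le3 le4.
  by rewrite subr_eq0 eqr_nat; apply/eqP; lia.
(* If the inequality were not strict, both [adj G] steps would preserve the rank; the step from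
   [(i, false)] to [(j, true)] could then be undone by a walk, and closedness would put the edge in
   [A]. *)
rewrite subr_lt0 ltr_nat ltnNge; apply/negP=> ge.
move/negP: ijA; apply; apply: closedA => //; apply: rk_eq => //; lia.
Qed.

End Potentials.

(** * Neighborliness and closed edge sets *)

Section Neighborly.

Local Open Scope ring_scope.
Local Open Scope classical_set_scope.
Variables (R : realType) (n k : nat) (G : graph n).

(** The functional of the face is turned into a potential; the walk gives the inequality opposite to
    the one for the edge, so the edge vector lies on the face. *)
Lemma neighborly_alt_closed (A : {set {set 'I_n}}) :
  neighborly k (edge_polytope R G) -> A \subset edges G -> (#|A| <= k)%N ->
  alt_closed G A.
Proof.
move=> nbr sA Ak i j ij conn.
have [|| F faceF vF] := nbr [set edge_vec R e | e in [set` A]].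
- by move=> _ [e eA <-]; apply/edge_vec_vertex/(fintype.subsetP sA).
- by rewrite (card_le_eql (card_edge_vec R A)) card_le_II.
have inF e : e \in A -> F (edge_vec R e).
  by move=> eA; apply: face_mem; rewrite -[face _ _]/(vertices F _) vF; exists e.
have eG : [set i; j]%SET \in edges G by rewrite edgeE.
suff Fe : F (edge_vec R [set i; j]%SET).
  have : vertices F (edge_vec R [set i; j]%SET).
    by apply: face_sub_vertex faceF _ Fe; apply: edge_vec_vertex.
  by rewrite vF => -[e eA /edge_vec_inj <-].
case: faceF inF => c [b [le_b ->]] inF.
have gen e : e \in edges G -> edge_polytope R G (edge_vec R e).
  by move=> e_in; rewrite edge_polytopeE; apply: sub_conv; exists e.
split; first exact: gen.
(* Every point of the polytope has coordinate sum 2, so the supporting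
   functional can be shifted to have value 0 on the face. *)
pose c0 : 'rV[R]_n := \row_l (c 0 l - b / 2).
have dotE u v : adj G u v -> dot c (edge_vec R [set u; v]%SET) = c0 0 u + c0 0 v + b.
  by move=> uv; rewrite dot_edge_vec ?(edge_neq uv) // !mxE addrACA -opprD -splitr subrK.
have c0_le u v : adj G u v -> c0 0 u + c0 0 v <= 0.
  move=> uv; rewrite -(lerD2r b) add0r -dotE //; apply: le_b.
  by apply: gen; rewrite edgeE.
have c0_eq u v : [set u; v]%SET \in A -> c0 0 u + c0 0 v = 0.
  move=> uvA; have uv := sub_in_edges sA uvA; apply: (addIr b).
  by rewrite add0r -dotE //; have [] := inF _ uvA.
have := walk_potential c0_le c0_eq conn; rewrite /= => le_ji.
rewrite /= -/(dot _ _) dotE //; suff -> : c0 0 i + c0 0 j = 0 by rewrite add0r.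
by apply/eqP; rewrite eq_le c0_le //= -lerBlDl sub0r.
Qed.

Lemma alt_closed_neighborly :
  (forall A : {set {set 'I_n}}, A \subset edges G -> (#|A| <= k)%N -> alt_closed G A) ->
  neighborly k (edge_polytope R G).
Proof.
move=> closedG A A_vert Ak.
(* All vertices of the polytope are edge vectors, so [A] comes from a set [B] of edges of the same
   cardinality. *)
pose B := finset (fun e => (e \in edges G) && `[< A (edge_vec R e) >]).
have BP e : reflect (e \in edges G /\ A (edge_vec R e)) (e \in B).
  by rewrite [e \in B]finset.in_set; apply: (iffP andP) => -[? /asboolP].
have sB : B \subset edges G by apply/fintype.subsetP=> e /BP[].
have defA : A = [set edge_vec R e | e in [set` B]].
  apply/seteqP; split=> [v Av | _ [e /BP[_ Ae] <-] //].
  have [e eG ev] := vertices_edge_polytope (A_vert v Av).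
  by exists e => //; apply/BP; rewrite ev.
have Bk : (#|B| <= k)%N.
  by rewrite -card_le_II -(card_le_eql (card_edge_vec R B)) -defA.
(* The potential is a functional that is at most 0 on the edges, with equality exactly on [B], so it
   cuts out the required face. *)
have [c cP] := exists_potential R (closedG B sB Bk).
have dotE u v : adj G u v -> dot c (edge_vec R [set u; v]%SET) = c 0 u + c 0 v.
  by move=> uv; rewrite dot_edge_vec ?(edge_neq uv).
have dot_le e : e \in edges G -> dot c (edge_vec R e) <= 0 ?= iff (e \in B).
  by case/edgeP=> u [v [uv ->]]; rewrite dotE //; apply: cP.
pose F := edge_polytope R G `&` [set x | dot c x = 0].
have faceF : face (edge_polytope R G) F.
  exists c, 0; split=> //; rewrite edge_polytopeE; apply: conv_dot_le.
  by move=> _ [e eG <-]; apply: (dot_le e eG).1.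
exists F => //; apply/seteqP; split=> [v vF | v Av].
  have [e eG ev] : edge_points G v.
    by move: faceF; rewrite edge_polytopeE => /vertex_face_gen; apply.
  have [_ /=] := face_mem vF; rewrite -ev => /eqP; rewrite (dot_le e eG).2 defA => eB.
  by exists e.
apply: face_sub_vertex faceF (A_vert v Av) _.
move: Av (A_vert v Av); rewrite {1}defA => -[e eB <-] _.
have [eG _] := BP e eB.
split; first by rewrite edge_polytopeE; apply: sub_conv; exists e.
by apply/eqP; rewrite /= (dot_le e eG).2.
Qed.

End Neighborly.

Theorem theorem4p1 (R : realType) (k n : nat) (G : graph n)
  (hk : 2 <= k) (hG : k <= #|edges G|) :
  neighborly k (edge_polytope R G) <-> F_free k G.
Proof.
split=> [nbr | free].
  by apply: alt_closed_F_free => A; apply: neighborly_alt_closed nbr.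
by apply: alt_closed_neighborly => A sA Ak; apply: F_free_alt_closed free.
Qed.
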